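(* Let $X$ be a uniformly convex Banach space and let $\{r_j\}_{j\ge1}$ be the sequence associated with $X$ by $r_1=1$ and, for every natural $j$, $r_{j+1}$ being the unique solution of $r_{j+1}\cdot\zeta^-_X(r_{j+1})=r_j$. Let $k\ge 1$ be a natural number, $\alpha\in(0,1]$ and $\beta=1-(1-\alpha)^{1/k}$. If $\mathcal{F}$ is a finite family of at least $k$ convex sets in $X$ such that for at least an $\alpha$ fraction of the $k$-tuples $K_1,\ldots,K_k$ of (distinct) members of $\mathcal{F}$ the set $\bigcap_{i=1}^kK_i$ contains a point of the unit ball $\mathbf{B}$, then there exists $x\in X$ such that at least $\beta|\mathcal{F}|$ elements of $\mathcal{F}$ intersect the ball $r_k\mathbf{B}+x$.
   Context: Banach spaces are real, of dimension at least $2$. $\mathbf{B}=\{x\in X:\|x\|\le1\}$; $|\mathcal F|$ is the size of $\mathcal F$. The modulus of convexity is $\delta_X(\varepsilon)=\inf\{1-\frac{\|x+y\|}{2}: x,y\in\mathbf{B},\ \|x-y\|\ge\varepsilon\}$, $\varepsilon\in[0,2]$; $X$ is uniformly convex if $\delta_X>0$ on $(0,2]$. For $x\ne0$, $y$ is quasi-orthogonal to $x$, written $y\urcorner x$, if there is a non-zero continuous linear functional $p$ with $p(x)=\|p\|\|x\|$ and $p(y)=0$ (equivalently, $\|x+\lambda y\|\ge\|x\|$ for all $\lambda\in\mathbb{R}$). The function $\zeta^-_X:[0,\infty)\to[0,\infty)$ is $\zeta^-_X(\varepsilon)=\inf\{\|x+\varepsilon y\|:\|x\|=\|y\|=1,\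 y\urcorner x\}$. The sequence $\{r_j\}$ is well-defined. *)

(* Defs.v *)
From HB Require Import structures.
From mathcomp Require Import all_boot all_order all_algebra.
From mathcomp Require Import all_classical all_reals all_analysis.
Import Order.TTheory GRing.Theory Num.Theory.
Import numFieldNormedType.Exports.

Set Implicit Arguments.
Unset Strict Implicit.
Unset Printing Implicit Defensive.

Local Open Scope classical_set_scope.
Local Open Scope ring_scope.

Definition unit_ball (R : realType) (X : normedModType R) : set X :=
  [set x | `|x| <= 1].
Arguments unit_ball {R} X.

(* r B + x, written as the image of the closed unit ball B; the library's
   closed_ball is the closure of an open ball, which is empty for r = 0. *)
Definition scaled_ball (R : realType) (X : normedModType R) (r : R) (x : X) :
  set X := [set r *: b + x | b in unit_ball X].

Definition dim_ge2 (R : realType) (X : lmodType R) : Prop :=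
  exists u v : X, forall a b : R, a *: u + b *: v = 0 -> a = 0 /\ b = 0.
Arguments dim_ge2 {R} X.

Definition modulus_convexity (R : realType) (X : normedModType R) (eps : R) : R :=
  inf [set d : R | exists x y : X,
    [/\ unit_ball X x, unit_ball X y, eps <= `|x - y| &
        d = 1 - `|x + y| / 2]].
Arguments modulus_convexity {R} X eps.

Definition uniformly_convex (R : realType) (X : normedModType R) : Prop :=
  forall eps : R, 0 < eps -> eps <= 2 -> 0 < modulus_convexity X eps.
Arguments uniformly_convex {R} X.

Definition functional_norm (R : realType) (X : normedModType R)
    (p : {linear X -> R^o}) : R :=
  sup [set `|p x| | x in unit_ball X].

Definition quasi_orthogonal (R : realType) (X : normedModType R) (y x : X) : Prop :=
  exists p : {linear X -> R^o},
    [/\ continuous p, exists z, p z != 0,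
        p x = functional_norm p * `|x| & p y = 0].

Definition zeta_minus (R : realType) (X : normedModType R) (eps : R) : R :=
  inf [set t : R | exists x y : X,
    [/\ `|x| = 1, `|y| = 1, quasi_orthogonal y x & t = `|x + eps *: y|]].
Arguments zeta_minus {R} X eps.

(* Indices start at 1; the value r 0 is irrelevant.  The condition 0 <= r j.+1
   records that [0, +oo) is the domain of zeta_minus. *)
Definition radii_sequence (R : realType) (X : normedModType R) (r : nat -> R) :
  Prop :=
  r 1%N = 1 /\
  forall j : nat, (1 <= j)%N ->
    0 <= r j.+1 /\ r j.+1 * zeta_minus X (r j.+1) = r j.
Arguments radii_sequence {R} X r.

Section families.
Variables (R : realType) (X : normedModType R) (I : finType) (F : I -> set X).

(* The k-tuples of distinct members of F are the injective maps 'I_k -> I. *)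
Definition num_tuples (k : nat) : nat :=
  #|[pred t : {ffun 'I_k -> I} | injectiveb t]|.

Definition num_good_tuples (k : nat) : nat :=
  #|[pred t : {ffun 'I_k -> I} | injectiveb t &&
      `[< (\bigcap_(i in [set: 'I_k]) F (t i)) `&` unit_ball X !=set0 >]]|.

Definition num_meeting (B : set X) : nat :=
  #|[pred i : I | `[< F i `&` B !=set0 >]]|.

End families.

(* Main.v *)
Require Import Defs.
From HB Require Import structures.
From mathcomp Require Import all_boot all_order all_algebra.
From mathcomp Require Import all_classical all_reals all_analysis.
From mathcomp Require Import ring lra.
Import Order.TTheory GRing.Theory Num.Theory.
Import numFieldNormedType.Exports.

Set Implicit Arguments.
Unset Strict Implicit.
Unset Printing Implicit Defensive.

Local Open Scope classical_set_scope.
Local Open Scope ring_scope.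

(** Suppose that every translate of the ball of radius r_k is met by fewer than
    beta |F| of the sets; then too many k-tuples have an intersection that
    avoids the unit ball B.

    Such bad tuples are built one set at a time.  Let x_0 = 0, and let x_j be a
    point of least norm in the intersection of K_1, ..., K_j; choose K_(j+1)
    among the sets that miss the ball r_k B + x_j.  There are more than
    (1 - beta) |F| of them, and none is one of K_1, ..., K_j, because these all
    contain x_j.  If the intersection is already empty, the tuple is lost
    anyway and K_(j+1) may be any set not yet chosen.

    These choices push the intersection away from the origin.  To begin with,
    |x_1| > r_k = r_k / r_1.  For j >= 1 let z lie in K_1, ..., K_(j+1).  Then
    |z - x_j| > r_k, and since x_j has least norm on the segment from x_j to z,
    some norming functional p of x_j satisfies p(z - x_j) >= 0.  Turning z - x_j
    into the kernel of p, within the plane that it spans with x_j, does not take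
    the sum farther from the origin, and neither does shortening it afterwards.
    Hence |z| >= |x_j| zeta(rho) for every rho with
    0 <= rho <= |z - x_j| / |x_j| ([norm_ge_zeta_minus]).
    If |x_j| > r_k / r_j, then either |x_j| > r_k / r_(j+1) and there is nothing
    to do, or rho = r_(j+1) is permitted and
    |z| > (r_k / r_j) zeta(r_(j+1)) = r_k / r_(j+1).  By induction the whole
    intersection of K_1, ..., K_k lies outside B ([admissible_norm]).

    Finally the numbers of choices are multiplied.  At step j there are at least
    (1 - beta) (|F| - j) choices, strictly more at step 0, so the bad tuples
    make up more than (1 - beta)^k = 1 - alpha of all tuples of distinct
    members, a contradiction.

    Points of least norm and norming functionals have to exist.  The first is
    arranged by shrinking each set to the convex hull of finitely many of its
    points, one for each good tuple that it belongs to: the hulls are compact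
    and every good tuple stays good ([compact_convex_cores]).  The second is the
    Hahn-Banach theorem, in the form that a minimal sublinear functional is
    linear ([hahn_banach]). *)

(** * Sublinear functionals and the Hahn-Banach theorem *)

(** Homogeneity is asked for as an inequality and for t > 0 only: this is all
    that has to be checked for infima, and equality together with the case
    t = 0 follows. *)
Definition sublinear (R : realType) (V : lmodType R) (q : V -> R) : Prop :=
  (forall u v, q (u + v) <= q u + q v) /\
  (forall t u, 0 < t -> q (t *: u) <= t * q u).

Section hahn_banach.
Variables (R : realType) (V : lmodType R).
Implicit Types (q : V -> R) (u v y : V).

Lemma sublinear0 q : sublinear q -> q 0 = 0.
Proof.
move=> [qD qZ]; have := qD 0 0; have := qZ 2^-1 0.
by rewrite addr0 scaler0 invr_gt0 => /(_ (ltr0Sn _ _)); lra.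
Qed.

Lemma sublinear_geN q v : sublinear q -> - q (- v) <= q v.
Proof.
move=> sq; have := sq.1 v (- v).
by rewrite subrr sublinear0//; lra.
Qed.

Lemma sublinear_scale_ge q t v : sublinear q -> 0 <= t -> t * q v <= q (t *: v).
Proof.
move=> sq; rewrite le_eqVlt => /predU1P[<-|t0].
  by rewrite mul0r scale0r sublinear0.
have := sq.2 t^-1 (t *: v); rewrite invr_gt0 => /(_ t0).
by rewrite scalerK ?gt_eqF// ler_pdivlMl.
Qed.

(** For c <= q y this is the largest sublinear functional below q that is at most
    - c at - y.  Linear bounds are imposed on sublinear functionals by this
    device, both to prove that minimal ones are linear, and to prescribe the
    values of the functional obtained in the end. *)
Definition tilt q y (c : R) v : R :=
  inf [set q (v + t *: y) - t * c | t in [set t : R | 0 <= t]].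

Section tilt.
Variables (q : V -> R) (y : V) (c : R).
Hypotheses (sq : sublinear q) (cq : c <= q y).

Lemma tilt_le v t : 0 <= t -> tilt q y c v <= q (v + t *: y) - t * c.
Proof.
move=> t0; apply: ge_inf; last by exists t.
exists (- q (- v)) => _ [s /= s0 <-].
have := sq.1 (v + s *: y) (- v); rewrite addrAC subrr add0r.
have := sublinear_scale_ge y sq s0.
have : s * c <= s * q y by rewrite ler_wpM2l.
lra.
Qed.

Lemma tilt_ge v (b : R) :
  (forall t, 0 <= t -> b <= q (v + t *: y) - t * c) -> b <= tilt q y c v.
Proof.
move=> h; apply: lb_le_inf; first by exists (q (v + 0 *: y) - 0 * c), 0 => /=.
by move=> _ [t /= t0 <-]; exact: h.
Qed.

Lemma tilt_sublinear : sublinear (tilt q y c).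
Proof.
split=> [u v|t u t0].
- suff h s : 0 <= s -> tilt q y c (u + v) - (q (u + s *: y) - s * c) <= tilt q y c v.
    rewrite -lerBlDr; apply: tilt_ge => s s0.
    by have := h s s0; lra.
  move=> s0; apply: tilt_ge => t t0.
  have := tilt_le (u + v) (addr_ge0 s0 t0).
  have := sq.1 (u + s *: y) (v + t *: y).
  by rewrite addrACA -scalerDl mulrDl; lra.
- rewrite -ler_pdivrMl//; apply: tilt_ge => s s0.
  rewrite ler_pdivrMl//.
  have ts0 : 0 <= t * s by rewrite mulr_ge0// ltW.
  apply: le_trans (tilt_le (t *: u) ts0) _.
  by rewrite -scalerA -scalerDr mulrBr -mulrA lerD2r; exact: sq.2.
Qed.

Lemma tilt_le_self v : tilt q y c v <= q v.
Proof. by have := tilt_le v (lexx 0); rewrite scale0r addr0 mul0r subr0. Qed.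

Lemma tilt_opp : tilt q y c (- y) <= - c.
Proof.
have := tilt_le (- y) ler01.
by rewrite scale1r addNr mul1r sublinear0// sub0r.
Qed.

End tilt.

(** Zorn's lemma: pointwise infima of chains are finite, because
    - q (- v) bounds from below the values at v of all the sublinear functionals
    below q, and they are subadditive, because of two members of a chain the
    smaller one may be used at both arguments. *)
Lemma minimal_sublinear q : sublinear q ->
  exists p, [/\ sublinear p, forall v, p v <= q v &
    forall p', sublinear p' -> (forall v, p' v <= p v) -> forall v, p v <= p' v].
Proof.
move=> sq.
pose T := {p : V -> R | sublinear p /\ forall v, p v <= q v}.
pose le_fun (s t : T) := `[< forall v, sval t v <= sval s v >].
have qT : sublinear q /\ forall v, q v <= q v by [].
have [||A Atot|[p [sp pq]] pmin] := @ZL_preorder T (exist _ q qT) le_fun.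
- by move=> t; apply/asboolP.
- move=> t s u /asboolP ts /asboolP su; apply/asboolP => v.
  exact: le_trans (su v) (ts v).
- have [->|/set0P[s0 As0]] := eqVneq A set0; first by exists (exist _ q qT).
  pose m v := inf [set sval s v | s in A].
  have mle s v : A s -> m v <= sval s v.
    move=> As; apply: ge_inf; last by exists s.
    exists (- q (- v)) => _ [s' As' <-]; have [ss' s'q] := svalP s'.
    have := sublinear_geN v ss'; have := s'q (- v); lra.
  have mge v b : (forall s, A s -> b <= sval s v) -> b <= m v.
    move=> h; apply: lb_le_inf; first by exists (sval s0 v), s0.
    by move=> _ [s As <-]; exact: h.
  have msub : sublinear m.
    split=> [u v|t u t0].
    + suff h s : A s -> m (u + v) - sval s u <= m v.
        by rewrite -lerBlDr; apply: mge => s /h; lra.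
      move=> As; apply: mge => s' As'.
      have [/asboolP ss'|/asboolP ss'] := Atot s s' As As'.
      * have := mle s' (u + v) As'; have := (svalP s').1.1 u v.
        by have := ss' u; lra.
      * have := mle s (u + v) As; have := (svalP s).1.1 u v.
        by have := ss' v; lra.
    + rewrite -ler_pdivrMl//; apply: mge => s As; rewrite ler_pdivrMl//.
      exact: le_trans (mle s _ As) ((svalP s).1.2 _ _ t0).
  have mq : sublinear m /\ forall v, m v <= q v.
    by split=> // v; exact: le_trans (mle _ v As0) ((svalP s0).2 v).
  by exists (exist _ m mq) => s As; apply/asboolP => v; exact: mle.
- exists p; split=> // p' sp' p'p.
  have p'T : sublinear p' /\ forall v, p' v <= q v.
    by split=> // v; exact: le_trans (p'p v) (pq v).
  have pp' : le_fun (exist _ p (conj sp pq)) (exist _ p' p'T) by apply/asboolP.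
  exact/asboolP/(pmin _ pp').
Qed.

(** A minimal sublinear p equals its tilt by any y with c = p y, whence
    p (- y) <= - p y; a sublinear functional that is odd is linear. *)
Lemma hahn_banach q : sublinear q ->
  exists p : {linear V -> R^o}, forall v, p v <= q v.
Proof.
move=> /minimal_sublinear[p [sp pq pmin]].
have pN y : p (- y) = - p y.
  apply/eqP; rewrite eq_le; apply/andP; split; last first.
    by have := sublinear_geN y sp; lra.
  apply: le_trans (tilt_opp sp (lexx (p y))).
  apply: pmin; first exact: tilt_sublinear.
  by move=> v; apply: tilt_le_self.
have pZ t u : 0 < t -> p (t *: u) = t * p u.
  move=> t0; apply/eqP; rewrite eq_le sp.2//=.
  by have := sp.2 t (- u) t0; rewrite scalerN !pN mulrN lerN2.
have plin : linear (p : V -> R^o).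
  move=> t u v; have -> : p (t *: u + v) = p (t *: u) + p v.
    apply/eqP; rewrite eq_le sp.1//=.
    have := sp.1 (t *: u + v) (- v); rewrite addrK pN; lra.
  congr (_ + _); have [t0|t0|->] := ltgtP t 0.
  - rewrite -[t]opprK scaleNr pN pZ ?oppr_gt0//.
    by rewrite scaleNr.
  - exact: pZ.
  - by rewrite !scale0r sublinear0.
pose pm := GRing.isLinear.Build R V R^o *:%R p plin.
pose pl : {linear V -> R^o} := HB.pack p pm.
by exists pl.
Qed.

End hahn_banach.

(** * Norming functionals and the modulus zeta *)

Section norming.
Variables (R : realType) (X : normedModType R).
Implicit Types (x y u v w : X) (p : {linear X -> R^o}).

Lemma norm_sublinear : sublinear (fun v : X => `|v|).
Proof.
split=> [u v|t u t0]; first exact: ler_normD.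
by rewrite normrZ gtr0_norm.
Qed.

(** The norm is tilted twice before [hahn_banach] applies: along x, which forces
    p x = |x|, then along w, which forces p w >= 0.  Minimality of |x| on the ray
    is exactly what the second tilt requires. *)
Lemma norming_functional x w : (forall s : R, 0 <= s -> `|x| <= `|x + s *: w|) ->
  exists p, [/\ forall v, p v <= `|v|, p x = `|x| & 0 <= p w].
Proof.
move=> xmin.
have s1 := tilt_sublinear norm_sublinear (lexx `|x|).
set q1 := tilt _ _ _ in s1.
have wq1 : 0 <= q1 w.
  apply: tilt_ge => t; rewrite le_eqVlt => /predU1P[<-|t0].
    by rewrite scale0r addr0 mul0r subr0.
  rewrite subr_ge0; have -> : w + t *: x = t *: (x + t^-1 *: w).
    by rewrite scalerDr scalerA divff ?gt_eqF// scale1r addrC.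
  rewrite normrZ gtr0_norm// ler_pM2l//; apply: xmin.
  by rewrite invr_ge0 ltW.
have [p pq2] := hahn_banach (tilt_sublinear s1 wq1).
have q2q1 v := tilt_le_self s1 wq1 v.
have q1q0 v := tilt_le_self norm_sublinear (lexx `|x|) v.
have pq1 v := le_trans (pq2 v) (q2q1 v).
have pn v := le_trans (pq1 v) (q1q0 v).
exists p; split=> //.
- apply/eqP; rewrite eq_le pn /=.
  have := le_trans (pq1 (- x)) (tilt_opp norm_sublinear (lexx `|x|)).
  by rewrite linearN lerN2.
- have := le_trans (pq2 (- w)) (tilt_opp s1 wq1).
  by rewrite linearN oppr0 oppr_le0.
Qed.

(** With the product of the field in place of the scaling of R^o, as [ring] and
    [lra] need it. *)
Lemma functionalZ p t v : p (t *: v) = t * p v.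
Proof. exact: linearZ. Qed.

Section contraction.
Variable p : {linear X -> R^o}.
Hypothesis pn : forall v, p v <= `|v|.

Lemma contraction_norm v : `|p v| <= `|v|.
Proof.
rewrite ler_norml pn andbT lerNl.
by have := pn (- v); rewrite linearN normrN.
Qed.

Lemma contraction_continuous : continuous p.
Proof.
apply: bounded_linear_continuous; apply/bounded_funP => r; exists r => v.
exact: le_trans (contraction_norm v).
Qed.

Lemma contraction_functional_norm x : `|x| = 1 -> p x = 1 -> functional_norm p = 1.
Proof.
move=> x1 px; apply/eqP; rewrite eq_le; apply/andP; split.
  apply: ge_sup; first by exists `|p x|, x; rewrite // /unit_ball/= x1.
  move=> _ [v /= v1 <-]; exact: le_trans (contraction_norm v) v1.
apply: ub_le_sup; last by exists x; rewrite /unit_ball/= ?x1// px normr1.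
by exists 1 => _ [v /= v1 <-]; exact: le_trans (contraction_norm v) v1.
Qed.

Lemma contraction_quasi_orthogonal x y : `|x| = 1 -> p x = 1 -> p y = 0 ->
  quasi_orthogonal y x.
Proof.
move=> x1 px py; exists p; split=> //; first exact: contraction_continuous.
  by exists x; rewrite px oner_eq0.
by rewrite (contraction_functional_norm x1 px) x1 mul1r.
Qed.

Lemma zeta_minus_le x u eps : `|x| = 1 -> `|u| = 1 -> p x = 1 -> p u = 0 ->
  zeta_minus X eps <= `|x + eps *: u|.
Proof.
move=> x1 u1 px pu; apply: ge_inf; last first.
  by exists x, u; split=> //; exact: contraction_quasi_orthogonal.
by exists 0 => _ [? [? [_ _ _ ->]]]; exact: normr_ge0.
Qed.

End contraction.

Lemma kernel_unit_vector p : dim_ge2 X -> exists u, `|u| = 1 /\ p u = 0.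
Proof.
move=> [e [f free_ef]].
suff [v v0 pv] : exists2 v, v != 0 & p v = 0.
  exists (`|v|^-1 *: v); rewrite functionalZ pv mulr0; split=> //.
  by rewrite normrZ normfV normr_id mulVf// normr_eq0.
have [pe|pe] := eqVneq (p e) 0.
  exists e => //; apply/eqP => e0; have := free_ef 1 0.
  by rewrite e0 scaler0 scale0r addr0 => /(_ erefl)[/eqP]; rewrite oner_eq0.
exists (p f *: e + (- p e) *: f).
  by apply/eqP => /free_ef[_ /eqP]; rewrite oppr_eq0 (negPf pe).
by rewrite linearD !functionalZ; ring.
Qed.

(** The convex function s |-> |x + s u| is minimal at 0, where p shows that it
    takes the value 1. *)
Lemma norm_add_perp_le p x u s t : (forall v, p v <= `|v|) -> `|x| = 1 -> p x = 1 ->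
  p u = 0 -> 0 <= s -> s <= t -> `|x + s *: u| <= `|x + t *: u|.
Proof.
move=> pn x1 px pu s0 st.
have [t0|t0] := leP t 0.
  by have -> : s = t by lra.
have xt : 1 <= `|x + t *: u|.
  by have := pn (x + t *: u); rewrite linearD functionalZ px pu mulr0 addr0.
have l0 : 0 <= s / t by rewrite divr_ge0// ltW.
have l1 : 0 <= 1 - s / t by rewrite subr_ge0 ler_pdivrMr// mul1r.
have -> : x + s *: u = (1 - s / t) *: x + (s / t) *: (x + t *: u).
  by rewrite scalerDr scalerA mulfVK ?gt_eqF// addrA -scalerDl subrK scale1r.
apply: le_trans (ler_normD _ _) _; rewrite 2!normrZ (ger0_norm l0) (ger0_norm l1) x1; nra.
Qed.

(** Monotonicity of the norm along a circle.  Let u be the direction of y - p(y) x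
    and l u the point where the segment from - x to y crosses the ray of u.
    If rho <= l, then |x + rho u| <= |x + l u| = |x + y| / (1 + p y).  If rho > l,
    the triangle inequality gives |x + rho u| <= |x + l u| + (rho - l), while
    |x + y| = |x + l u| + |y - l u| and |y - l u| >= |y| - l >= rho - l. *)
Lemma perp_direction p x y rho : dim_ge2 X ->
  (forall v, p v <= `|v|) -> `|x| = 1 -> p x = 1 -> 0 <= p y ->
  0 <= rho -> rho <= `|y| ->
  exists u, [/\ `|u| = 1, p u = 0 & `|x + rho *: u| <= `|x + y|].
Proof.
move=> dimX pn x1 px; set a : R := p y => a0 rho0 rhoy.
have [y'0|y'0] := eqVneq (y - a *: x) 0.
  (* y is a multiple of x, and any unit vector of the kernel will do. *)
  have [u [u1 pu]] := kernel_unit_vector p dimX.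
  exists u; split=> //; apply: le_trans (ler_normD _ _) _.
  move/eqP: y'0; rewrite subr_eq0 => /eqP ya.
  rewrite normrZ u1 x1 mulr1 ger0_norm//.
  have ya' : `|y| = a by rewrite ya normrZ x1 mulr1 ger0_norm.
  have := pn (x + y); rewrite linearD px -/a; lra.
pose c := `|y - a *: x|; have c0 : 0 < c by rewrite normr_gt0.
pose u := c^-1 *: (y - a *: x).
have yE : y = a *: x + c *: u.
  by rewrite /u scalerA divff ?gt_eqF// scale1r addrC subrK.
have u1 : `|u| = 1 by rewrite normrZ normfV normr_id mulVf ?gt_eqF.
have pu : p u = 0.
  by rewrite functionalZ linearB functionalZ px -/a mulr1 subrr mulr0.
exists u; split=> //.
have a1 : 0 < 1 + a by lra.
pose l := c / (1 + a); have l0 : 0 <= l by rewrite divr_ge0 ?ltW.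
have xQ : x + y = (1 + a) *: (x + l *: u).
  rewrite scalerDr scalerA mulrC mulfVK ?gt_eqF//.
  by rewrite scalerDl scale1r -addrA -yE.
have nQ : `|x + y| = (1 + a) * `|x + l *: u| by rewrite xQ normrZ gtr0_norm.
have [rl|lr] := leP rho l.
  have := norm_add_perp_le pn x1 px pu rho0 rl; rewrite nQ.
  have := normr_ge0 (x + l *: u); nra.
have -> : x + rho *: u = (x + l *: u) + (rho - l) *: u.
  by rewrite -addrA -scalerDl [l + _]addrC subrK.
apply: le_trans (ler_normD _ _) _.
rewrite normrZ u1 mulr1 gtr0_norm ?subr_gt0// nQ mulrDl mul1r lerD2l.
have -> : a * `|x + l *: u| = `|y - l *: u|.
  rewrite -[in LHS](ger0_norm a0) -normrZ; congr `|_|.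
  rewrite yE scalerDr scalerA -addrA -scalerBl; congr (_ + _ *: _).
  by rewrite /l; field; rewrite gt_eqF.
have := lerB_normD y (- (l *: u)).
rewrite normrN normrZ u1 mulr1 (ger0_norm l0); lra.
Qed.

(** The growth of the norm beyond a point x of least norm: [perp_direction] for
    x / |x| and (z - x) / |x|. *)
Lemma norm_ge_zeta_minus x z rho : dim_ge2 X -> 0 < `|x| ->
  (forall s : R, 0 <= s -> s <= 1 -> `|x| <= `|x + s *: (z - x)|) ->
  0 <= rho -> rho * `|x| <= `|z - x| ->
  `|x| * zeta_minus X rho <= `|z|.
Proof.
move=> dimX x0 xmin rho0 rhox.
(* By convexity, minimality on the segment extends to the whole ray. *)
have xmin' s : 0 <= s -> `|x| <= `|x + s *: (z - x)|.
  move=> s0; have [|s1] := leP s 1; first exact: xmin.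
  have := xmin s^-1; rewrite invr_ge0 s0 invf_le1 ?(lt_trans ltr01)// ltW// => /(_ isT isT).
  have := xmin 1 ler01 (lexx _); rewrite scale1r.
  have -> : x + (z - x) = (1 - s^-1) *: x + s^-1 *: (x + s *: (z - x)).
    rewrite [in RHS]scalerDr scalerA mulVf ?gt_eqF ?(lt_trans ltr01)// scale1r.
    by rewrite [RHS]addrA -scalerDl subrK scale1r.
  move=> h _; have := le_trans h (ler_normD _ _).
  rewrite !normrZ.
  have i0 : 0 < s^-1 by rewrite invr_gt0 (lt_trans ltr01).
  have i1 : s^-1 <= 1 by rewrite invf_le1 ?(lt_trans ltr01)// ltW.
  rewrite (gtr0_norm i0) ger0_norm ?subr_ge0//; nra.
have [p [pn px pw]] := norming_functional xmin'.
have ix0 : 0 < `|x|^-1 by rewrite invr_gt0.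
have x1 : `|(`|x|^-1 *: x)| = 1 by rewrite normrZ gtr0_norm// mulVf ?gt_eqF.
have px1 : p (`|x|^-1 *: x) = 1.
  by rewrite functionalZ px mulVf ?gt_eqF.
have pw1 : 0 <= p (`|x|^-1 *: (z - x)).
  by rewrite functionalZ mulr_ge0// ltW.
have rhow : rho <= `|(`|x|^-1 *: (z - x))|.
  by rewrite normrZ gtr0_norm// ler_pdivlMl// mulrC.
have [u [u1 pu]] := perp_direction dimX pn x1 px1 pw1 rho0 rhow.
rewrite -scalerDr [x + _]addrC subrK normrZ gtr0_norm// ler_pdivlMl//.
apply: le_trans; rewrite ler_pM2l//; exact: zeta_minus_le pn _ _ _ x1 u1 px1 pu.
Qed.

End norming.

(** * Compact convex hulls of finitely many points *)

Section compact_convex.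
Variables (R : realType) (X : normedModType R).
Implicit Types (A C : set X) (x y z : X).

Lemma convex_setP A : convex_set A <->
  forall x y (t : R), 0 <= t -> t <= 1 -> A x -> A y -> A (t *: x + (1 - t) *: y).
Proof.
split=> [cA x y t t0 t1 Ax Ay|cA x y t].
  have := cA x y (Itv01 t0 t1); rewrite !inE; exact.
rewrite !inE => Ax Ay; exact: cA.
Qed.

(** The union of the segments from x to the points of C, written as the image of a
    product so that its compactness is that of a continuous image. *)
Definition cone_join x C : set X :=
  [set p.1 *: x + (1 - p.1) *: p.2 | p in `[0, 1] `*` C].

Lemma cone_join_compact x C : compact C -> compact (cone_join x C).
Proof.
move=> cC; apply: continuous_compact.
  apply: continuous_subspaceT => p.
  apply: cvgD; first by apply: cvgZr_tmp; exact: cvg_fst.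
  apply: cvgZ; last exact: cvg_snd.
  by apply: cvgB; [exact: cvg_cst|exact: cvg_fst].
by apply: compact_setX => //; exact: segment_compact.
Qed.

Lemma cone_join_convex x C : convex_set C -> convex_set (cone_join x C).
Proof.
move=> /convex_setP cC; apply/convex_setP.
move=> _ _ s s0 s1 [[t c] [/= /[!in_itv]/= /andP[t0 t1] Cc] <-]
  [[t' c'] [/= /[!in_itv]/= /andP[t'0 t'1] Cc'] <-].
pose T := s * t + (1 - s) * t'.
have T0 : 0 <= T by rewrite addr_ge0// mulr_ge0// subr_ge0.
have T1 : T <= 1 by rewrite /T; nra.
(* If T = 1, all the weight is on x and any point of C serves as second end. *)
have [E|E] := eqVneq T 1.
  exists (T, c); first by split; rewrite //= in_itv/= T0 T1.
  have st : s * (1 - t) = 0 by move: E; rewrite /T; nra.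
  have st' : (1 - s) * (1 - t') = 0 by move: E; rewrite /T; nra.
  rewrite /= E subrr scale0r addr0 !scalerDr !scalerA st st' !scale0r !addr0.
  by rewrite -scalerDl -/T E.
have T1' : 0 < 1 - T by rewrite subr_gt0 lt_neqAle E.
pose u := s * (1 - t) / (1 - T).
have u0 : 0 <= u by rewrite divr_ge0 ?(ltW T1')// mulr_ge0 ?subr_ge0.
have u1 : u <= 1.
  by rewrite ler_pdivrMr// mul1r /T; nra.
exists (T, u *: c + (1 - u) *: c').
  by split; rewrite /= ?in_itv/= ?T0 ?T1//; exact: cC.
rewrite ![s *: _]scalerDr ![(1 - s) *: _]scalerDr !scalerA.
have -> : (1 - T) *: (u *: c + (1 - u) *: c') =
    (s * (1 - t)) *: c + ((1 - s) * (1 - t')) *: c'.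
  rewrite scalerDr !scalerA; congr (_ *: _ + _ *: _).
    by rewrite mulrC mulfVK ?gt_eqF.
  rewrite mulrBr mulr1 [X in _ - X]mulrC mulfVK ?gt_eqF// /T; ring.
by rewrite /= [in LHS]/T scalerDl [RHS]addrACA.
Qed.

(** The hull is built by joining one point at a time; the empty list, for which
    [cone_join] would lose the apex, is treated apart. *)
Lemma compact_convex_hull A (s : seq X) : convex_set A ->
  (forall x, x \in s -> A x) ->
  exists C, [/\ compact C, convex_set C, C `<=` A & forall x, x \in s -> C x].
Proof.
move=> cA; case: s => [|x s]; first by exists set0; split; [exact: compact0|..] => // x y t; rewrite inE.
elim: s x => [|y s IH] x sA.
  exists [set x]; split; first exact: compact_set1.
  - apply/convex_setP => _ _ t _ _ -> ->.
    by rewrite -scalerDl addrC subrK scale1r.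
  - by move=> _ ->; apply: sA; rewrite inE.
  - by move=> y; rewrite inE => /eqP.
have [|C [cptC cC CA sC]] := IH y; first by move=> z zs; apply: sA; rewrite inE zs orbT.
exists (cone_join x C); split.
- exact: cone_join_compact.
- exact: cone_join_convex.
- move=> _ [[t c] [/= /[!in_itv]/= /andP[t0 t1] /CA Ac] <-].
  by move/convex_setP: cA; apply=> //; apply: sA; rewrite inE eqxx.
- move=> z; rewrite inE => /predU1P[->|/sC Cz].
    exists (1, y); first by split; rewrite /= ?in_itv/= ?ler01 ?lexx//; exact/sC/mem_head.
    by rewrite /= subrr scale0r addr0 scale1r.
  exists (0, z); first by split; rewrite /= ?in_itv/= ?ler01 ?lexx.
  by rewrite /= subr0 scale0r add0r scale1r.
Qed.

Lemma compact_min_norm C : compact C -> C !=set0 ->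
  exists2 x, C x & forall z, C z -> `|x| <= `|z|.
Proof.
move=> cC C0; have [|x /[!inE] Cx xmin] := @compact_EVT_min _ R (fun x : X => `|x|) _ C0 cC.
  by apply: continuous_subspaceT => x; exact: norm_continuous.
by exists x => // z Cz; apply: xmin; rewrite inE.
Qed.

Lemma scaled_ballP r x z : 0 < r -> scaled_ball r x z <-> `|z - x| <= r.
Proof.
move=> r0; split=> [[b /= b1 <-]|zx].
  by rewrite addrK normrZ gtr0_norm// ler_piMr// ltW.
exists (r^-1 *: (z - x)); last by rewrite scalerA divff ?gt_eqF// scale1r subrK.
by rewrite /unit_ball/= normrZ gtr0_norm ?invr_gt0// ler_pdivrMl// mulr1.
Qed.

End compact_convex.

(** * Counting tuples built by successive choices *)

Section choice_tree.
Variables (I : finType) (A : seq I -> pred I).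

(** Choices are prepended: the tail of a sequence is the list of the choices made
    earlier, so that extending a tuple is [cons]. *)
Fixpoint admissible (s : seq I) : bool :=
  if s is i :: s' then A s' i && admissible s' else true.

Lemma card_admissible (m : nat -> nat) (k : nat) :
  (forall s, (size s < k)%N -> (m (size s) <= #|A s|)%N) ->
  (\prod_(j < k) m j <= #|[pred t : k.-tuple I | admissible t]|)%N.
Proof.
elim: k => [|k IH] mA.
  rewrite big_ord0; apply/card_gt0P; exists [tuple]; by rewrite inE.
rewrite big_ord_recr/=.
pose P (p : k.-tuple I * I) := admissible p.1 && A p.1 p.2.
pose f (p : k.-tuple I * I) := [tuple of p.2 :: p.1].
have f_inj : injective f.
  by move=> [t i] [t' i'] /(congr1 val)/= [-> /val_inj ->].
apply: (@leq_trans #|P|); last first.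
  rewrite -(card_in_image (in2W f_inj)); apply: subset_leq_card.
  apply/fintype.subsetP => _ /fintype.imageP[p Pp ->].
  by rewrite inE /= andbC.
rewrite -sum1_card -(pair_big_dep (fun t : k.-tuple I => admissible t)
  (fun (t : k.-tuple I) i => A t i) (fun _ _ => 1%N))/=.
apply: (@leq_trans (\sum_(t : k.-tuple I | admissible t) m k)).
  rewrite sum_nat_const leq_mul2r; apply/orP; right.
  apply: leq_trans (IH _) _ => [s sk|]; first by apply: mA; exact: ltnW.
  by [].
apply: leq_sum => t _; rewrite sum1_card.
by have := mA t; rewrite size_tuple => /(_ (ltnSn _)).
Qed.

End choice_tree.

(** * Greedy tuples have intersections far from the origin *)

Section greedy.
Variables (R : realType) (X : normedModType R) (I : finType) (G : I -> set X).
Hypotheses (Gcompact : forall i, compact (G i)) (Gconvex : forall i, convex_set (G i)).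
Implicit Types (s : seq I) (i : I).

Definition meet s : set X := [set x | forall i, i \in s -> G i x].

Lemma meet_cons i s : meet (i :: s) = G i `&` meet s.
Proof.
apply/seteqP; split=> x /=.
  by move=> h; split=> [|j js]; apply: h; rewrite inE ?eqxx ?js ?orbT.
by move=> [Gix sx] j; rewrite inE => /predU1P[->|/sx].
Qed.

Lemma meet_convex s : convex_set (meet s).
Proof.
apply/convex_setP => x y t t0 t1 sx sy i si.
by have /convex_setP := @Gconvex i; apply=> //; [exact: sx|exact: sy].
Qed.

(** The intersection of no sets is the whole space, which is not compact but
    has 0 as its point of least norm. *)
Lemma meet_min_norm s : meet s !=set0 ->
  exists2 x, meet s x & forall z, meet s z -> `|x| <= `|z|.
Proof.
case: s => [_|i s]; first by exists 0 => // z _; rewrite normr0.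
apply: compact_min_norm; rewrite meet_cons; apply: compact_closedI => //.
have -> : meet s = \bigcap_(i in [set i | i \in s]) G i by [].
by apply: closed_bigI => j _; apply: compact_closed => //; exact: norm_hausdorff.
Qed.

Variables (rad : R) (center : seq I -> X).
Hypothesis rad0 : 0 < rad.
Hypothesis center_meet : forall s, meet s !=set0 -> meet s (center s).
Hypothesis center_min : forall s z, meet s z -> `|center s| <= `|z|.

(** The sets that may follow the choices s.  Once the intersection is empty,
    distance from the centre says nothing and only repetitions are excluded. *)
Definition far s i : bool :=
  if `[< meet s !=set0 >] then `[< ~ (G i `&` scaled_ball rad (center s) !=set0) >]
  else i \notin s.

(** The centre lies in every set chosen so far, so these sets meet the ball around
    it. *)
Lemma far_notin s i : far s i -> i \notin s.
Proof.
rewrite /far; case: asboolP => // s0 /asboolP h; apply/negP => si.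
apply: h; exists (center s); split; first exact: center_meet.
by apply/scaled_ballP => //; rewrite subrr normr0 ltW.
Qed.

Lemma far_dist s i z : far s i -> meet (i :: s) z -> rad < `|z - center s|.
Proof.
rewrite /far meet_cons => + [Giz sz]; case: asboolP => [_|[]]; last by exists z.
move=> /asboolP h; rewrite ltNge; apply/negP => zc; apply: h; exists z.
by split=> //; exact/scaled_ballP.
Qed.

Lemma admissible_uniq s : admissible far s -> uniq s.
Proof. by elim: s => //= i s IH /andP[/far_notin -> /IH]. Qed.

Lemma card_far m s : (forall x : X, m + num_meeting G (scaled_ball rad x) <= #|I|)%N ->
  (minn m (#|I| - size s) <= #|far s|)%N.
Proof.
move=> mG; have [s0|s0] := pselect (meet s !=set0).
  apply: leq_trans (geq_minl _ _) _.
  rewrite -(leq_add2r (num_meeting G (scaled_ball rad (center s)))).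
  apply: leq_trans (mG _) _; rewrite -(cardC (far s)) leq_add2l.
  apply: subset_leq_card; apply/fintype.subsetP => i; rewrite !inE /far asboolT//.
  by move=> /asboolPn/contrapT.
apply: leq_trans (geq_minr _ _) _.
rewrite leq_subLR -(cardC (mem s)) leq_add ?card_size//.
apply: subset_leq_card; apply/fintype.subsetP => i; rewrite !inE /far asboolF//.
Qed.

Variable r : nat -> R.
Hypotheses (dimX : dim_ge2 X) (hr : radii_sequence X r).

Lemma radii_gt0 j : 0 < r j.+1.
Proof.
elim: j => [|j IH]; first by rewrite hr.1 ltr01.
have [rj0 rjE] := hr.2 j.+1 isT.
rewrite lt_neqAle rj0 andbT; apply/eqP => r0.
by move: IH; rewrite -rjE -r0 mul0r ltxx.
Qed.

(** Induction on the number of choices; each of them gains the factor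
    zeta(r_(j+1)) = r_j / r_(j+1) unless the centre is already far enough out. *)
Lemma admissible_norm i s z : admissible far (i :: s) -> meet (i :: s) z ->
  rad / r (size s).+1 < `|z|.
Proof.
elim: s i z => [|j s IH] i z /andP[iA As] iz; have xz := far_dist iA iz.
  have c0 : center [::] = 0.
    by apply/eqP; rewrite -normr_le0 -(normr0 X); exact: center_min.
  by rewrite hr.1 divr1; move: xz; rewrite c0 subr0.
have js0 : meet (j :: s) !=set0.
  by exists z; move: iz; rewrite meet_cons => -[].
have xm := IH _ _ As (center_meet js0).
have sz : meet (j :: s) z by move: iz; rewrite meet_cons => -[].
have xzm := center_min sz.
have xs := center_meet js0.
move: (center (j :: s)) xz xm xzm xs (@center_min (j :: s)) => x xz xm xzm xs xmin.
set n := (size s).+1 in xm *; rewrite -[size (j :: s)]/n.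
have [xr|rx] := ltP (rad / r n.+1) `|x|; first exact: lt_le_trans xzm.
have [_ rE] := hr.2 n isT.
have rn0 : 0 < r n := radii_gt0 (size s).
have rn1 : 0 < r n.+1 := radii_gt0 n.
have zeta0 : 0 < zeta_minus X (r n.+1) by rewrite -(pmulr_rgt0 _ rn1) rE.
have x0 : 0 < `|x| by apply: lt_trans xm; rewrite divr_gt0.
have <- : rad / r n * zeta_minus X (r n.+1) = rad / r n.+1.
  by rewrite -rE; field; rewrite !gt_eqF.
apply: (@lt_le_trans _ _ (`|x| * zeta_minus X (r n.+1))); first by rewrite ltr_pM2r.
apply: norm_ge_zeta_minus => //; last 2 first.
- exact: ltW.
- by apply: le_trans (ltW xz); move: rx; rewrite ler_pdivlMr// mulrC.
move=> t t0 t1; apply: xmin.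
have -> : x + t *: (z - x) = t *: z + (1 - t) *: x.
  by rewrite scalerBr scalerBl scale1r addrCA.
by move/convex_setP: (@meet_convex (j :: s)); apply.
Qed.

End greedy.

(** * Bad tuples are numerous *)

Section counting.
Variables (R : realType) (X : normedModType R) (I : finType).
Implicit Types (F G : I -> set X) (k : nat).

(** Choose a point of B in the intersection of every good tuple, and let G i be
    the hull of the points chosen for the tuples in which F i occurs; the point
    chosen for t then witnesses that t is still good for G. *)
Lemma compact_convex_cores F k : (forall i, convex_set (F i)) ->
  exists G, [/\ forall i, compact (G i), forall i, convex_set (G i),
    forall i, G i `<=` F i &
    forall t : {ffun 'I_k -> I},
      (\bigcap_(i in [set: 'I_k]) F (t i)) `&` unit_ball X !=set0 ->
      (\bigcap_(i in [set: 'I_k]) G (t i)) `&` unit_ball X !=set0].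
Proof.
move=> convF.
pose good (t : {ffun 'I_k -> I}) x :=
  ((\bigcap_(i in [set: 'I_k]) F (t i)) `&` unit_ball X) x.
have /choice[pt ptP] t : exists x, good t !=set0 -> good t x.
  have [[x gx]|ng] := pselect (good t !=set0); first by exists x.
  by exists 0.
have /choice[G GP] i : exists C, [/\ compact C, convex_set C, C `<=` F i &
    forall t : {ffun 'I_k -> I}, good t !=set0 -> i \in codom t -> C (pt t)].
  pose s := [seq pt t | t in [pred t : {ffun 'I_k -> I} |
    `[< good t !=set0 >] && (i \in codom t)]].
  have [|C [cptC cC CF sC]] := compact_convex_hull (s := s) (convF i).
    move=> x /fintype.imageP[t /andP[/asboolP gt /codomP[j ->]] ->].
    by have [+ _] := ptP t gt; exact.
  exists C; split=> // t gt it; apply: sC; apply/fintype.imageP; exists t => //.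
  by rewrite inE it andbT; apply/asboolP.
exists G; split=> [i|i|i|t gt]; try by have [] := GP i.
exists (pt t); split; last by have [] := ptP t gt.
by move=> j _; have [_ _ _] := GP (t j); apply=> //; exact: codom_f.
Qed.

Lemma num_meeting_mono F G (B : set X) : (forall i, G i `<=` F i) ->
  (num_meeting G B <= num_meeting F B)%N.
Proof.
move=> GF; apply: subset_leq_card; apply/fintype.subsetP => i.
by rewrite !inE => -[x [Gx Bx]]; exists x; split=> //; exact: GF.
Qed.

(** Admissible tuples for the compact cores are injective, and they are bad by
    [admissible_norm] with rad = r k, for which rad / r k = 1. *)
Lemma num_bad_tuples F k (r : nat -> R) (m : nat) :
  dim_ge2 X -> radii_sequence X r -> (0 < k)%N -> (forall i, convex_set (F i)) ->
  (forall x : X, m + num_meeting F (scaled_ball (r k) x) <= #|I|)%N ->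
  (num_good_tuples F k + \prod_(j < k) minn m (#|I| - j) <= num_tuples I k)%N.
Proof.
move=> dimX hr k0 convF mF.
have [G [Gcompact Gconvex GF Ggood]] := compact_convex_cores k convF.
have rk0 : 0 < r k by rewrite -(prednK k0); exact: radii_gt0 hr _.
have /choice[c cP] s : exists x, meet G s !=set0 ->
    meet G s x /\ forall z, meet G s z -> `|x| <= `|z|.
  have [s0|ns] := pselect (meet G s !=set0); last by exists 0.
  by have [x sx xmin] := meet_min_norm Gcompact s0; exists x.
have c_meet s : meet G s !=set0 -> meet G s (c s) by case/cP.
have c_min s z : meet G s z -> `|c s| <= `|z|.
  by move=> sz; have [|_] := cP s; [exists z|exact].
have mG x : (m + num_meeting G (scaled_ball (r k) x) <= #|I|)%N.
  by apply: leq_trans (mF x); rewrite leq_add2l num_meeting_mono.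
pose A := far G (r k) c.
have le_prod : (\prod_(j < k) minn m (#|I| - j) <=
    #|[pred t : k.-tuple I | admissible A t]|)%N.
  apply: (card_admissible (m := fun j => minn m (#|I| - j))) => s _.
  exact: card_far.
pose good := [pred t : {ffun 'I_k -> I} |
  `[< (\bigcap_(i in [set: 'I_k]) F (t i)) `&` unit_ball X !=set0 >]].
rewrite /num_tuples /num_good_tuples -[leqRHS](cardID good) leq_add//.
apply: leq_trans le_prod _.
pose f (t : k.-tuple I) : {ffun 'I_k -> I} := [ffun j => tnth t j].
have f_inj : injective f.
  by move=> t t' /ffunP tt'; apply: eq_from_tnth => j; have := tt' j; rewrite !ffunE.
rewrite -(card_in_image (in2W f_inj)); apply: subset_leq_card.
apply/fintype.subsetP => _ /fintype.imageP[t At ->]; rewrite !inE.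
apply/andP; split.
  apply/asboolP => /Ggood[z [zG z1]].
  have tz : meet G t z.
    by move=> i /tnthP[j ->]; have := zG j Logic.I; rewrite ffunE.
  have : `|z| <= 1 := z1; apply/negP; rewrite -ltNge.
  have := size_tuple t; move: At tz; rewrite inE; case: (val t) => [|i s] At tz sk.
    by rewrite -sk in k0.
  have := admissible_norm Gconvex rk0 c_meet c_min dimX hr At tz.
  by rewrite -[(size s).+1]/(size (i :: s)) sk divff ?gt_eqF.
apply/injectiveP => i j; rewrite !ffunE.
have /tuple_uniqP := admissible_uniq rk0 c_meet At.
exact.
Qed.

End counting.

(** Each factor q (n - j) is at most min(m, n - j), since q n < m and q <= 1.
    Strictness comes from the factor j = 0 and survives because the other factors
    min(m, n - j) are positive. *)
Lemma prod_minn_gt (R : realType) (q : R) (n m k : nat) :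
  (0 < k)%N -> (k <= n)%N -> 0 <= q -> q <= 1 -> (m <= n)%N ->
  q * n%:R < m%:R ->
  q ^+ k * (n ^_ k)%:R < (\prod_(j < k) minn m (n - j))%:R.
Proof.
move=> k0 kn q0 q1 mn qm.
have -> : q ^+ k * (n ^_ k)%:R = \prod_(j < k) (q * (n - j)%:R).
  by rewrite ffact_prod natr_prod big_split/= prodr_const card_ord.
rewrite natr_prod.
have factor_le j : q * (n - j)%:R <= (minn m (n - j))%:R.
  rewrite natr_min le_min; apply/andP; split; last by rewrite ler_piMl.
  by apply: le_trans (ltW qm); rewrite ler_wpM2l// ler_nat leq_subr.
have m0 : (0 < m)%N by rewrite -(ltr_nat R); apply: le_lt_trans qm; rewrite mulr_ge0.
case: k k0 kn => // k _ kn; rewrite !big_ord_recl/= subn0 (minn_idPl mn).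
have pos : 0 < \prod_(i < k) (minn m (n - bump 0 i))%:R :> R.
  apply: prodr_gt0 => i _; rewrite ltr0n leq_min m0 subn_gt0/=.
  exact: leq_trans (ltn_ord (lift ord0 i)) kn.
apply: le_lt_trans (_ : q * n%:R * \prod_(i < k) (minn m (n - bump 0 i))%:R < _).
  rewrite ler_wpM2l ?mulr_ge0//; apply: ler_prod => i _.
  by rewrite mulr_ge0//= factor_le.
by rewrite ltr_pM2r.
Qed.

Theorem theorem4p3 (R : realType) (X : completeNormedModType R)
    (dimX : dim_ge2 X) (ucX : uniformly_convex X)
    (r : nat -> R) (hr : radii_sequence X r)
    (k : nat) (k1 : (1 <= k)%N)
    (alpha beta : R) (alpha0 : 0 < alpha) (alpha1 : alpha <= 1)
    (hbeta : beta = 1 - (1 - alpha) `^ (k%:R^-1))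
    (I : finType) (F : I -> set X) (sizeF : (k <= #|I|)%N)
    (convF : forall i : I, convex_set (F i))
    (hF : alpha * (num_tuples I k)%:R <= (num_good_tuples F k)%:R) :
  exists x : X, beta * #|I|%:R <= (num_meeting F (scaled_ball (r k) x))%:R.
Proof.
apply: contrapT => no_ball.
set q := (1 - alpha) `^ (k%:R^-1) in hbeta.
have q0 : 0 <= q := powR_ge0 _ _.
have qk : q ^+ k = 1 - alpha.
  rewrite -powR_mulrn// /q -powRrM mulVf ?pnatr_eq0 -?lt0n// powRr1//.
  by rewrite subr_ge0.
have q1 : q <= 1.
  rewrite leNgt; apply/negP => q1; have := exprn_egt1 k q1.
  by rewrite qk -lt0n k1; lra.
(* The least integer above q |F|, hence a lower bound for every integer above it. *)
pose m := (Num.truncn (q * #|I|%:R)).+1.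
have qm : q * #|I|%:R < m%:R by exact: truncnS_gt.
have few x : (m + num_meeting F (scaled_ball (r k) x) <= #|I|)%N.
  have meetI : (num_meeting F (scaled_ball (r k) x) <= #|I|)%N := max_card _.
  rewrite -(subnK meetI) leq_add2r truncn_lt_nat ?mulr_ge0// natrB//.
  have : ~ beta * #|I|%:R <= (num_meeting F (scaled_ball (r k) x))%:R.
    by move=> big; apply: no_ball; exists x.
  by move=> /negP; rewrite -ltNge hbeta; lra.
have mI : (m <= #|I|)%N := leq_trans (leq_addr _ _) (few 0).
have := num_bad_tuples dimX hr k1 convF few.
rewrite -(ler_nat R) natrD.
have := prod_minn_gt k1 sizeF q0 q1 mI qm.
have tuplesE : num_tuples I k = (#|I| ^_ k)%N.
  rewrite -[in RHS](card_ord k) -card_inj_ffuns.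
  by apply: eq_card => t; rewrite !inE.
rewrite -tuplesE qk => bad /(lt_le_trans (ler_ltD hF bad)).
by rewrite -mulrDl addrC subrK mul1r ltxx.
Qed.
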